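(* Let $n\geq 2$ be an integer and let $q$ be a prime power with $q>4n/\ln(2)$. Then in $\mathrm{PG}(2n-1,q)$ there exists a higgledy-piggledy set of lines of size at most $2(2n-1)-2=4n-4$; that is, there exists a strong blocking set $\mathcal{S}$ in $\mathrm{PG}(2n-1,q)$ which is the union of at most $4n-4$ lines $\ell_1,\dots,\ell_{4n-4}$.
   Context: $\mathrm{PG}(N,q)$ denotes the $N$-dimensional projective space over the finite field $\mathbb{F}_q$. A strong blocking set in $\mathrm{PG}(N,q)$ is a set of points $\mathcal{S}$ such that for every hyperplane $H$, the points of $\mathcal{S}\cap H$ span $H$. A set of lines of $\mathrm{PG}(N,q)$ is a higgledy-piggledy set if the set of points contained in at least one of its lines is a strong blocking set. *)

(* Defs.v *)
From HB Require Import structures.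
From mathcomp Require Import all_boot all_order all_algebra.
From mathcomp Require Import reals exp.

Set Implicit Arguments.
Unset Strict Implicit.
Unset Printing Implicit Defensive.

Import Order.TTheory GRing.Theory Num.Theory.

Local Open Scope ring_scope.

HB.instance Definition _ (F : finFieldType) (vT : vectType F) :
    isCountable {vspace vT} :=
  CanIsCountable (@VectorInternalTheory.vs2mxK F vT).
HB.instance Definition _ (F : finFieldType) (vT : vectType F) :
    isFinite {vspace vT} :=
  CanIsFinite (@VectorInternalTheory.vs2mxK F vT).

(* Subspaces of PG(N, q) are the nonzero vector subspaces of F ^ (N + 1).
   [k] is the vector dimension, one more than the projective dimension, so
   points, lines and hyperplanes have k = 1, 2 and N respectively. *)
Definition pg_subspace (F : finFieldType) (N k : nat) :=
  {U : {vspace 'rV[F]_N.+1} | \dim U == k}.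

Definition pg_point (F : finFieldType) (N : nat) := pg_subspace F N 1.
Definition pg_line (F : finFieldType) (N : nat) := pg_subspace F N 2.
Definition pg_hyperplane (F : finFieldType) (N : nat) := pg_subspace F N N.

HB.instance Definition _ (F : finFieldType) (N k : nat) :=
  Finite.on (pg_subspace F N k).
HB.instance Definition _ (F : finFieldType) (N k : nat) :=
  SubType.on (pg_subspace F N k).
HB.instance Definition _ (F : finFieldType) (N : nat) :=
  Finite.on (pg_point F N).
HB.instance Definition _ (F : finFieldType) (N : nat) :=
  SubType.on (pg_point F N).
HB.instance Definition _ (F : finFieldType) (N : nat) :=
  Finite.on (pg_line F N).
HB.instance Definition _ (F : finFieldType) (N : nat) :=
  SubType.on (pg_line F N).
HB.instance Definition _ (F : finFieldType) (N : nat) :=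
  Finite.on (pg_hyperplane F N).
HB.instance Definition _ (F : finFieldType) (N : nat) :=
  SubType.on (pg_hyperplane F N).

Definition points_of (F : finFieldType) (N k : nat) (U : pg_subspace F N k) :
    {set pg_point F N} :=
  [set P | (val P <= val U)%VS].

Definition pg_span (F : finFieldType) (N : nat) (S : {set pg_point F N}) :
    {vspace 'rV[F]_N.+1} :=
  (\sum_(P in S) val P)%VS.

Definition strong_blocking_set (F : finFieldType) (N : nat)
    (S : {set pg_point F N}) : Prop :=
  forall H : pg_hyperplane F N, pg_span (S :&: points_of H) = val H.

Definition higgledy_piggledy (F : finFieldType) (N : nat)
    (L : {set pg_line F N}) : Prop :=
  strong_blocking_set (\bigcup_(l in L) points_of l).

(* Main.v *)
Require Import Defs.
From mathcomp Require Import all_boot all_order all_algebra.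
From mathcomp Require Import reals exp.
From mathcomp Require Import ring lra zify sequences.
Import Order.TTheory GRing.Theory Num.Theory.
Set Implicit Arguments.
Unset Strict Implicit.
Unset Printing Implicit Defensive.
Local Open Scope ring_scope.

(** The lines are chosen at random from a Desarguesian line spread.  Let
    [q = #|F|] and [d = 2n], and let [J] be a matrix on [F ^ d] whose minimal
    polynomial [X^2 - X - t] has no root in [F].  Then [K = F[J]] is a field
    with [q ^ 2] elements, [F ^ d] is a [K]-space, and each nonzero vector [v]
    gives the line [K v], spanned by [v] and [v J].

    Suppose the points of a union of such lines that lie on a hyperplane [H]
    span only [W < H].  A functional [a] with kernel [H] and a functional [b]
    that vanishes on [W] but not on [H] are independent, and every line meets
    [H], hence meets the codimension two space [ker a :&: ker b]
    ([unmet_klines_blocking]).  So it suffices to find [m = 4n - 4] vectors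
    whose lines do not all meet the same codimension two space.

    The line of [v] meets [ker a :&: ker b] exactly when [v] is annihilated by
    [K c] for one of the [q + 1] members [c] of the pencil of [a] and [b], up
    to scalars; each [c] accounts for [q ^ (d - 2)] vectors [v], so a random
    line is met with probability at most [(q + 1) / q ^ 2] ([card_meets]).
    There are at most [q ^ (2d) = q ^ (m + 4)] pairs [(a, b)], so [m] random
    lines have on average at most [q ^ 4 * (1 + 1 / q) ^ m < 2 * q ^ 4] pairs
    that meet all of them, because [(1 + 1 / q) ^ m <= exp (4n / q) < 2].

    This average exceeds 1, but pairs that meet all lines come in large
    families: changing the basis of the pencil or multiplying it by an element
    of [K] changes nothing, as the lines are [K]-invariant.  If [b] is not in
    [K a] this produces more than [2 * q ^ 4] pairs, about [q ^ 5]
    ([orbit_pair_inj], [card_orbit_index]).  If [b] is in [K a], then [K a]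
    annihilates all the chosen vectors, which for [m] random vectors is very
    unlikely.  Weighing the second event by the size of the families, one
    first moment computation excludes both ([exists_unmet_family]). *)

(** * The quadratic extension field F[J] *)

(** The map [x |-> x ^ 2 - x] identifies 0 and 1, so on a finite field it is
    not surjective; this gives an irreducible quadratic polynomial
    [X^2 - X - t] in every characteristic. *)
Lemma exists_non_artin_schreier (F : finFieldType) :
  exists t : F, forall x : F, x ^+ 2 - x != t.
Proof.
have /injectivePn : ~~ injectiveb (fun x : F => x ^+ 2 - x).
  apply/negP => /injectiveP /(_ 0 1); rewrite expr0n expr1n /= !subrr.
  by move=> /(_ erefl) /esym/eqP; rewrite oner_eq0.
move=> [x0 [y0 ne0 eq0]].
have [t tN] : exists t : F, t \notin codom (fun x : F => x ^+ 2 - x).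
  apply/existsP; apply: contraNT ne0; rewrite negb_exists => /forallP surj.
  have : #|codom (fun x : F => x ^+ 2 - x)| == #|F|.
    by apply/eqP/eq_card => x; have := surj x; rewrite negbK => ->.
  move=> /image_injP inj; apply/eqP.
  exact: (inj _ _ isT isT eq0).
by exists t => x; apply: contraNneq tN => <-; apply: codom_f.
Qed.

Lemma exists_quadratic_matrix (F : pzRingType) (n d : nat) (t : F) :
  d = (n + n)%N -> exists J : 'M[F]_d, J *m J = J + t%:M.
Proof.
move=> ->; exists (block_mx 0 1%:M t%:M 1%:M).
rewrite mulmx_block scalar_mx_block add_block_mx !mul0mx !mul1mx !mulmx1 !add0r.
by rewrite mulmx0 add0r !addr0 (addrC t%:M).
Qed.

Section QuadraticField.

Variables (F : finFieldType) (t : F) (d : nat) (J : 'M[F]_d).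
Hypothesis t_irr : forall x : F, x ^+ 2 - x != t.
Hypothesis JJ : J *m J = J + t%:M.

(** [k] holds the coordinates of an element of [K = F[J]] on the basis
    [1, J]. *)
Definition kmx (k : F * F) : 'M[F]_d := k.1%:M + k.2 *: J.

Lemma kmxB k l : kmx (k - l) = kmx k - kmx l.
Proof. by rewrite /kmx /= raddfB scalerBl opprD addrACA. Qed.

Lemma kmx_mul k l :
  kmx k *m kmx l =
  kmx (k.1 * l.1 + t * (k.2 * l.2), k.1 * l.2 + k.2 * l.1 + k.2 * l.2).
Proof.
rewrite /kmx /= mulmxDl !mulmxDr -!scalemxAl -!scalemxAr JJ.
rewrite !mul_scalar_mx !mul_mx_scalar.
by apply/matrixP => i j; rewrite !mxE; case: (i == j);
   rewrite ?mulr1n ?mulr0n; ring.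
Qed.

(** The inverse of [x + y J] is its conjugate [x + y - y J] divided by its norm
    [x^2 + x y - t y^2], and a zero of the norm with [y != 0] would make
    [- x / y] a root of [X^2 - X - t]. *)
Lemma kmx_inv k : k != 0 -> exists l, kmx l *m kmx k = 1%:M.
Proof.
move=> k0; pose N := k.1 ^+ 2 + k.1 * k.2 - t * k.2 ^+ 2.
have N0 : N != 0.
  have [k2|k2] := eqVneq k.2 0.
    rewrite /N k2 mulr0 expr0n mulr0 subr0 addr0 expf_neq0 //.
    by apply: contraNneq k0 => k1; rewrite (surjective_pairing k) k1 k2.
  apply: contraNneq (t_irr (- (k.1 / k.2))) => N0.
  apply/eqP; rewrite -[t](mulfK (expf_neq0 2 k2)).
  have -> : t * k.2 ^+ 2 = k.1 ^+ 2 + k.1 * k.2.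
    by apply/esym/eqP; rewrite -subr_eq0 -/N N0.
  by field.
exists ((k.1 + k.2) / N, - k.2 / N); rewrite kmx_mul /= /kmx /=.
have -> : (k.1 + k.2) / N * k.2 + - k.2 / N * k.1 + - k.2 / N * k.2 = 0 by ring.
have -> : (k.1 + k.2) / N * k.1 + t * (- k.2 / N * k.2) = 1.
by rewrite -(divff N0); rewrite /N; ring.
by rewrite scale0r addr0.
Qed.

Lemma kmx_inj (p : nat) (c : 'M[F]_(d, p)) k :
  kmx k *m c = 0 -> k != 0 -> c = 0.
Proof.
by move=> kc0 /kmx_inv[l lk]; rewrite -[c]mul1mx -lk -mulmxA kc0 mulmx0.
Qed.

(** The functional [c] vanishes on the whole [K]-line of [v]. *)
Definition kills (v : 'rV[F]_d) (c : 'cV[F]_d) : bool :=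
  (v *m c == 0) && (v *m J *m c == 0).

Lemma killsP v c : reflect (forall k, v *m kmx k *m c = 0) (kills v c).
Proof.
apply: (iffP andP) => [[/eqP vc /eqP vJc] k|vk].
  rewrite mulmxDr mulmxDl mul_mx_scalar -scalemxAr -!scalemxAl vc vJc.
  by rewrite !scaler0 addr0.
have := vk (1, 0); have := vk (0, 1).
rewrite /kmx /= !scale1r scale0r addr0 mulmx1 -scalemx1 scale0r add0r.
by move=> -> ->.
Qed.

Lemma kills_mul k v c : kills v c -> kills v (kmx k *m c).
Proof.
move=> /killsP vc; apply/killsP => l.
by rewrite !mulmxA -(mulmxA v) kmx_mul.
Qed.

Lemma killsZ x v c : kills v c -> kills v (x *: c).
Proof.
move=> /andP[/eqP vc /eqP vJc].
by rewrite /kills -!scalemxAr vc vJc !scaler0 eqxx.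
Qed.

Lemma kills_mulV k v c : k != 0 -> kills v (kmx k *m c) -> kills v c.
Proof.
by move=> /kmx_inv[l lk] /(kills_mul l); rewrite mulmxA lk mul1mx.
Qed.

Lemma kills_row k v c : k != 0 -> kills (v *m kmx k) c -> kills v c.
Proof.
move=> /kmx_inv[l lk] /killsP vc; apply/killsP => r.
have := vc (l.1 * r.1 + t * (l.2 * r.2), l.1 * r.2 + l.2 * r.1 + l.2 * r.2).
rewrite -(mulmxA v) -kmx_mul.
have -> : kmx k *m (kmx l *m kmx r) = kmx r.
  by rewrite mulmxA (mulmx1C lk) mul1mx.
by [].
Qed.

End QuadraticField.

(** * Counting lemmas *)

(** A left inverse [U] of [M] makes [(v, x) |-> v + x U] injective on the
    product of the kernel of [M] and [F ^ r]. *)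
Lemma card_left_kernel (F : finFieldType) (d r : nat) (M : 'M[F]_(d, r)) :
  row_full M ->
  (#|[set v : 'rV[F]_d | v *m M == 0]%R| * #|F| ^ r <= #|F| ^ d)%N.
Proof.
move=> /row_fullP[U UM].
have inj : {in setX [set v : 'rV[F]_d | v *m M == 0] [set: 'rV[F]_r] &,
             injective (fun p => p.1 + p.2 *m U)}.
  move=> [v x] [w y] /setXP[/= + _] /setXP[/= + _] e.
  rewrite !inE => /eqP vM /eqP wM.
  have xy : x = y.
    by have := congr1 (mulmx^~ M) e;
       rewrite /= !mulmxDl vM wM !add0r -!mulmxA UM !mulmx1.
  by move: e; rewrite xy => /addIr ->.
have := subset_leq_card (subsetT ((fun p => p.1 + p.2 *m U) @:
  setX [set v : 'rV[F]_d | v *m M == 0] [set: 'rV[F]_r])).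
by rewrite (card_in_imset inj) cardsX !cardsT !card_mx !mul1n.
Qed.

(** First moment of the number of objects [p] such that [D p] holds at each of
    [m] independently chosen points. *)
Lemma sum_card_forall (P X : finType) (m : nat) (Q : pred P) (D : P -> pred X)
    (A : nat) :
  (forall p, Q p -> (#|[set x | D p x]| <= A)%N) ->
  (\sum_(v : {ffun 'I_m -> X}) #|[set p | Q p && [forall i, D p (v i)]]| <=
   #|P| * A ^ m)%N.
Proof.
move=> DA.
have -> : (\sum_(v : {ffun 'I_m -> X})
      #|[set p | Q p && [forall i, D p (v i)]]| =
    \sum_(p | Q p) #|[set x | D p x]| ^ m)%N.
  transitivity (\sum_(v : {ffun 'I_m -> X})
      \sum_(p | Q p) [forall i, D p (v i)])%N.
    apply: eq_bigr => v _; rewrite -sum1_card big_mkcond [RHS]big_mkcond /=.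
    by apply: eq_bigr => p _; rewrite inE; case: (Q p).
  rewrite exchange_big; apply: eq_bigr => p _ /=.
  rewrite -[m in RHS]card_ord -card_ffun_on -sum1_card [RHS]big_mkcond /=.
  apply: eq_bigr => v _.
  have -> : (v \in ffun_on [set x | D p x]) = [forall i, D p (v i)].
    by apply: eq_forallb => i; rewrite inE.
  by case: ifP.
rewrite -sum_nat_const big_mkcond /=; apply: leq_sum => p _.
by case: ifP => // Qp; case: m => // m; rewrite leq_exp2r // DA.
Qed.

(** * Pencils of functionals and random lines *)

Section Pencils.

Variables (F : finFieldType) (t : F) (d : nat) (J : 'M[F]_d).
Hypothesis t_irr : forall x : F, x ^+ 2 - x != t.
Hypothesis JJ : J *m J = J + t%:M.
Local Notation q := #|F|.
Local Notation kmx := (kmx J).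
Local Notation kills := (kills J).

Lemma card_kills (c : 'cV[F]_d) :
  c != 0 -> (#|[set v | kills v c]| * q ^ 2 <= q ^ d)%N.
Proof.
move=> c0; pose M := row_mx c (J *m c).
have Mfull : row_full M.
  have : row_free M^T.
    apply: inj_row_free => w; rewrite -[w]hsubmxK.
    rewrite [lsubmx w]mx11_scalar [rsubmx w]mx11_scalar.
    move: (lsubmx w 0 0) (rsubmx w 0 0) => x y.
    rewrite tr_row_mx mul_row_col !mul_scalar_mx => /(congr1 trmx).
    rewrite linearD !linearZ /= !trmxK trmx0 => e.
    have : (x, y) == 0.
      apply: contraNT c0 => xy0; apply/eqP; apply: (kmx_inj t_irr JJ _ xy0).
      by rewrite /kmx /= mulmxDl mul_scalar_mx -scalemxAl.
    by move=> /eqP[-> ->]; rewrite !raddf0 row_mx0.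
  by rewrite -row_leq_rank -col_leq_rank mxrank_tr.
rewrite (eq_card (B := [set v | v *m M == 0])) ?card_left_kernel // => v.
rewrite !inE /kills mul_mx_row -row_mx0 mulmxA.
by apply/andP/eqP => [[/eqP-> /eqP->]|/eq_row_mx[-> ->]].
Qed.

(** For [v != 0] and independent [a] and [b], the line of [v] has a point in
    common with [ker a :&: ker b] if and only if the [2 x 2] matrix of values of
    [a] and [b] at [v] and [v J] is singular.  This is expressed by a dependency
    between its columns, because that puts a single functional in charge of the
    whole line. *)
Definition meets (a b : 'cV[F]_d) (v : 'rV[F]_d) : bool :=
  [exists k : F * F, (k != 0) && kills v (k.1 *: a + k.2 *: b)].

Definition indep (a b : 'cV[F]_d) : bool :=
  [forall k : F * F, (k.1 *: a + k.2 *: b == 0) ==> (k == 0)].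

(** The members of the pencil are [a] and the [b + x a], up to scalars. *)
Lemma card_meets a b : indep a b ->
  (#|[set v | meets a b v]| * q ^ 2 <= q.+1 * q ^ d)%N.
Proof.
move=> /forallP ab.
pose pt (o : option F) := if o is Some x then b + x *: a else a.
have pt0 o : pt o != 0.
  case: o => [x|]; apply/eqP; rewrite /pt => e.
    have := ab (x, 1); rewrite /= scale1r addrC e eqxx /= => /eqP[_ /eqP].
    by rewrite oner_eq0.
  have := ab (1, 0); rewrite /= scale1r scale0r addr0 e eqxx /= => /eqP[/eqP].
  by rewrite oner_eq0.
have sub : [set v | meets a b v] \subset \bigcup_o [set v | kills v (pt o)].
  apply/subsetP => v; rewrite inE => /existsP[[x y] /andP[/= xy0 kv]].
  apply/bigcupP; have [y0|y0] := eqVneq y 0.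
    exists None => //; rewrite inE /=.
    have x0 : x != 0 by apply: contraNneq xy0 => ->; rewrite y0.
    have := killsZ x^-1 kv.
    by rewrite y0 scale0r addr0 scalerA mulVf // scale1r.
  exists (Some (y^-1 * x)) => //; rewrite inE /=.
  by have := killsZ y^-1 kv; rewrite scalerDr !scalerA mulVf // scale1r addrC.
apply: leq_trans (_ : (\sum_o #|[set v | kills v (pt o)]|) * q ^ 2 <= _)%N.
  rewrite leq_mul2r; apply/orP; right; apply: leq_trans (subset_leq_card sub) _.
  elim/big_rec2: _ => [|o n A _ le_n]; first by rewrite cards0.
  by apply: leq_trans (leq_card_setU _ _) _; rewrite leq_add2l.
rewrite big_distrl /= -card_option -sum_nat_const.
by apply: leq_sum => o _; apply: card_kills.
Qed.

Lemma indepP a b :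
  reflect (forall x y : F, x *: a + y *: b = 0 -> x = 0 /\ y = 0) (indep a b).
Proof.
apply: (iffP forallP) => [ab x y e|ab [x y]].
  by have := ab (x, y); rewrite /= e eqxx /= => /eqP[].
by apply/implyP => /eqP /ab[/= -> ->].
Qed.

(** If [b] lies in [K a], then every nonzero member of the pencil spans [K a]
    over [K]. *)
Lemma meets_kline a b v k :
  indep a b -> b = kmx k *m a -> meets a b v -> kills v a.
Proof.
move=> /indepP ab bk /existsP[[x y] /andP[/= xy0 kv]].
have ca : x *: a + y *: b = kmx (x + y * k.1, y * k.2) *m a.
  rewrite bk /kmx /= !mulmxDl !mul_scalar_mx -!scalemxAl.
  by rewrite scalerDr scalerDl !scalerA addrA.
have l0 : (x + y * k.1, y * k.2) != 0.
  apply: contraNneq xy0 => l0; have := ca.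
  rewrite l0 /kmx /= scale0r addr0 raddf0 mul0mx.
  by move=> /ab[-> ->].
by apply: (kills_mulV t_irr JJ l0); rewrite -ca.
Qed.

(** A choice of representatives for the bases, up to [K]-multiples, of the
    pencil of [a] and [b]: for [g = ((k, x), (y, w))] the new pair is
    [k (b + x a)] and [k (y (b + x a) + w a)].  Only bases whose first member
    involves [b] are listed, and that member is normalized, so that [k] can be
    recovered from the pair. *)
Definition orbit_pair (a b : 'cV[F]_d) (g : ((F * F) * F) * (F * F)) :=
  let c := b + g.1.2 *: a in
  (kmx g.1.1 *m c, kmx g.1.1 *m (g.2.1 *: c + g.2.2 *: a)).

Definition orbit_index : {set ((F * F) * F) * (F * F)} :=
  setX (setX [set k : F * F | k != 0] [set: F])
       (setX [set: F] [set w : F | w != 0]).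

Lemma card_orbit_index :
  #|orbit_index| = ((q ^ 2).-1 * q * (q * q.-1))%N.
Proof.
rewrite !cardsX !cardsT !cardsE (cardC1 (0 : F)) (cardC1 (0 : F * F)%R).
by rewrite card_prod expnS expn1.
Qed.

Lemma orbit_pair_indep a b g :
  g \in orbit_index -> indep a b ->
  indep (orbit_pair a b g).1 (orbit_pair a b g).2.
Proof.
case: g => [[k X] [Y W]]; rewrite !inE /= => /andP[/andP[k0 _] W0] /indepP ab.
apply/indepP => x y; rewrite !scalemxAr -mulmxDr.
move=> /(kmx_inj t_irr JJ)/(_ k0) e.
have /ab[eX ey] : ((x + y * Y) * X + y * W) *: a + (x + y * Y) *: b = 0.
  rewrite -e; apply/matrixP => i j; rewrite !mxE; ring.
move: eX; rewrite ey mul0r add0r => /eqP.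
rewrite mulf_eq0 (negPf W0) orbF => /eqP y0.
by move: ey; rewrite y0 mul0r addr0.
Qed.

Lemma orbit_pair_meets a b g v :
  g \in orbit_index -> meets a b v ->
  meets (orbit_pair a b g).1 (orbit_pair a b g).2 v.
Proof.
case: g => [[k X] [Y W]]; rewrite !inE /= => /andP[/andP[k0 _] W0].
move=> /existsP[[x y] /andP[/= xy0 kv]]; pose z := (x - X * y) / W.
apply/existsP; exists (y - Y * z, z); apply/andP; split => /=.
  apply: contraNneq xy0 => -[+ z0]; rewrite z0 mulr0 subr0 => y0.
  move/eqP: z0; rewrite /z mulf_eq0 invr_eq0 (negPf W0) orbF y0 mulr0 subr0.
  by move=> /eqP ->.
rewrite !scalemxAr -mulmxDr; apply: (kills_mul JJ).
suff -> : (y - Y * z) *: (b + X *: a) + z *: (Y *: (b + X *: a) + W *: a) =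
          x *: a + y *: b by [].
by rewrite /z; apply/matrixP => i j; rewrite !mxE; field.
Qed.

(** If two indices with [k != k'] gave the same pair, comparing the first
    members would give [(k - k') b] in [K a], hence [b] in [K a]. *)
Lemma orbit_pair_inj a b :
  indep a b -> (forall k, b != kmx k *m a) ->
  {in orbit_index &, injective (orbit_pair a b)}.
Proof.
move=> /indepP ab bK [[k X] [Y W]] [[k' X'] [Y' W']].
rewrite !inE /= => /andP[/andP[k0 _] W0] /andP[/andP[k'0 _] W'0].
rewrite /orbit_pair /= => -[e1 e2].
have kk : k = k'.
  apply/eqP; rewrite -subr_eq0; apply: contraT => kk.
  have [l lk] := kmx_inv t_irr JJ kk.
  pose r := (X' * k'.1 - X * k.1, X' * k'.2 - X * k.2).
  have e : kmx (k - k') *m b = kmx r *m a.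
    have -> : kmx r = X' *: kmx k' - X *: kmx k.
      by apply/matrixP => i j; rewrite !mxE /=; case: (i == j);
         rewrite ?mulr1n ?mulr0n; ring.
    rewrite kmxB !mulmxBl -!scalemxAl; apply/eqP; rewrite -subr_eq0; apply/eqP.
    move: e1; rewrite !mulmxDr -!scalemxAr => /eqP.
    rewrite -subr_eq0 => /eqP <-.
    by apply/matrixP => i j; rewrite !mxE; ring.
  have eb : b = kmx l *m kmx r *m a by rewrite -mulmxA -e mulmxA lk mul1mx.
  by move/eqP: eb; rewrite (kmx_mul JJ) (negPf (bK _)).
subst k'.
have inj u w : kmx k *m u = kmx k *m w -> u = w :> 'cV_d.
  move=> e; apply/eqP; rewrite -subr_eq0; apply/eqP.
  by apply: (kmx_inj t_irr JJ _ k0); rewrite mulmxBr e subrr.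
have := inj _ _ e1 => /addrI e1'.
have [/subr0_eq XX _] : X - X' = 0 /\ (0 : F) = 0.
  by apply: ab; rewrite scalerBl e1' subrr scale0r addr0.
subst X'.
have e := inj _ _ e2.
have /ab[eW eY] : ((Y - Y') * X + (W - W')) *: a + (Y - Y') *: b = 0.
  move/eqP: e; rewrite -subr_eq0 => /eqP e; rewrite -e.
  by apply/matrixP => i j; rewrite !mxE; ring.
move: eW; rewrite eY mul0r add0r => /eqP; rewrite subr_eq0 => /eqP ->.
by move/eqP: eY; rewrite subr_eq0 => /eqP ->.
Qed.

(** Average over all [v] the number of pairs that meet every [v i], plus
    [M = #|orbit_index|] times the number of nonzero functionals that kill every
    [v i].  The hypothesis makes this average less than [M], so some [v] has a
    value below [M].  Then no nonzero functional kills every [v i], and a single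
    pair that meets every [v i] would bring along its [M] transforms. *)
Lemma exists_unmet_family (m : nat) :
  (q ^ (2 * d) * q.+1 ^ m + #|orbit_index| * q ^ d <
   #|orbit_index| * q ^ (2 * m))%N ->
  exists v : {ffun 'I_m -> 'rV[F]_d},
    forall a b, indep a b -> exists i, ~~ meets a b (v i).
Proof.
set M := #|orbit_index| => big_M.
pose B1 (v : {ffun 'I_m -> 'rV[F]_d}) :=
  [set p : 'cV[F]_d * 'cV[F]_d |
    indep p.1 p.2 && [forall i, meets p.1 p.2 (v i)]].
pose B2 (v : {ffun 'I_m -> 'rV[F]_d}) :=
  [set c : 'cV[F]_d | (c != 0) && [forall i, kills (v i) c]].
have [v vM] : exists v, (#|B1 v| + M * #|B2 v| < M)%N.
  apply/existsP; apply: contraLR big_M.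
  rewrite negb_exists -leqNgt => /forallP all_bad.
  pose A1 := ((q.+1 * q ^ d) %/ q ^ 2)%N; pose A2 := (q ^ d %/ q ^ 2)%N.
  have q0 : (0 < q)%N by apply/card_gt0P; exists 0.
  have le1 : (\sum_v #|B1 v| <= q ^ (2 * d) * A1 ^ m)%N.
    have -> : (q ^ (2 * d) = #|{: 'cV[F]_d * 'cV[F]_d}|)%N.
      by rewrite card_prod card_mx muln1 -expnD addnn mul2n.
    apply: (@sum_card_forall _ _ m (fun p => indep p.1 p.2)
      (fun p => meets p.1 p.2)) => p pind.
    by rewrite leq_divRL ?expn_gt0 ?q0 // card_meets.
  have le2 : (\sum_v #|B2 v| <= q ^ d * A2 ^ m)%N.
    have -> : (q ^ d = #|{: 'cV[F]_d}|)%N by rewrite card_mx muln1.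
    apply: (@sum_card_forall _ _ m (fun c => c != 0)
      (fun c => kills^~ c)) => c c0.
    by rewrite leq_divRL ?expn_gt0 ?q0 // card_kills.
  have : (\sum_(v : {ffun 'I_m -> 'rV[F]_d}) M <=
          q ^ (2 * d) * A1 ^ m + M * (q ^ d * A2 ^ m))%N.
    apply: leq_trans (leq_add le1 (leq_mul (leqnn M) le2)).
    rewrite big_distrr -big_split /=; apply: leq_sum => v _.
    by rewrite leqNgt all_bad.
  rewrite sum_nat_const card_ffun card_ord card_mx mul1n => le3.
  have leA1 : ((A1 * q ^ 2) ^ m <= (q.+1 * q ^ d) ^ m)%N.
    by case: (m) => // n; rewrite leq_exp2r // leq_trunc_div.
  have leA2 : ((A2 * q ^ 2) ^ m <= (q ^ d) ^ m)%N.
    by case: (m) => // n; rewrite leq_exp2r // leq_trunc_div.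
  rewrite (expnMn A1) (expnMn q.+1) -!expnM in leA1.
  rewrite (expnMn A2) -!expnM in leA2.
  rewrite -(leq_pmul2l (m := q ^ (d * m))) ?expn_gt0 ?q0 //.
  rewrite -expnM in le3.
  have := leq_mul le3 (leqnn (q ^ (2 * m))).
  move: leA1 leA2; move: (q ^ (2 * m))%N (q ^ (d * m))%N (A1 ^ m)%N (A2 ^ m)%N.
  move: (q.+1 ^ m)%N (q ^ (2 * d))%N (q ^ d)%N.
  clear => z u w a b x y h3 h4 h5.
  have := leq_mul (leqnn u) h3; have := leq_mul (leqnn (M * w)) h4; nia.
exists v.
have B20 : B2 v = set0.
  apply/eqP; rewrite -cards_eq0; case: #|B2 v| vM => // n.
  by rewrite mulnS addnCA ltnNge leq_addr.
move=> a b ab; apply/existsP; rewrite -negb_forall; apply/negP => all_meet.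
have bK k : b != kmx k *m a.
  apply/eqP => bk; suff : a \in B2 v by rewrite B20 inE.
  rewrite inE; apply/andP; split.
    apply: contraTneq ab => a0; apply/negP => /indepP/(_ 1 0).
    rewrite a0 !scaler0 scale0r addr0 => /(_ erefl)[/eqP].
    by rewrite oner_eq0.
  by apply/forallP => i; apply: meets_kline ab bk _; apply: (forallP all_meet).
move: vM; rewrite B20 cards0 muln0 addn0 ltnNge => /negP; apply.
rewrite /M -(card_in_imset (orbit_pair_inj ab bK)); apply: subset_leq_card.
apply/subsetP => _ /imsetP[g gI ->]; rewrite inE orbit_pair_indep //=.
by apply/forallP => i; apply: orbit_pair_meets gI _; apply: (forallP all_meet).
Qed.

End Pencils.

(** * From functionals to hyperplanes *)

(** One coordinate of the projection [1 - projv U], whose kernel is [U]. *)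
Lemma separating_functional (F : fieldType) (d : nat)
    (U : {vspace 'rV[F]_d}) w :
  w \notin U ->
  exists a : 'cV[F]_d, (forall u, u \in U -> u *m a = 0) /\ w *m a != 0.
Proof.
move=> wU; pose p : 'End('rV[F]_d) := (\1 - projv U)%VF.
have pE u : p u = u - projv U u by rewrite !lfun_simp.
have /rV0Pn[j pwj] : p w != 0.
  by apply: contra wU; rewrite pE subr_eq0 => /eqP ->; apply: memv_proj.
pose M := lin1_mx p; have ME u : u *m col j M = col j (p u).
  by rewrite colE mulmxA mul_rV_lin1 -colE.
exists (col j M); split=> [u uU|].
  by rewrite ME pE projv_id // subrr raddf0.
by rewrite ME; apply: contraNneq pwj => /matrixP/(_ 0 0); rewrite !mxE => ->.
Qed.

Section SpreadLines.

Variables (F : finFieldType) (t : F) (N : nat) (J : 'M[F]_N.+1).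
Hypothesis t_irr : forall x : F, x ^+ 2 - x != t.
Hypothesis JJ : J *m J = J + t%:M.

Definition kline (v : 'rV[F]_N.+1) : {vspace 'rV[F]_N.+1} :=
  (<[v]> + <[v *m J]>)%VS.

Lemma mem_klineP v u : reflect (exists k, u = v *m kmx J k) (u \in kline v).
Proof.
apply: (iffP memv_addP) => [[_ /vlineP[x ->] [_ /vlineP[y ->] ->]]|[k ->]].
  by exists (x, y); rewrite /kmx /= mulmxDr mul_mx_scalar -scalemxAr.
exists (k.1 *: v); first by rewrite memvZ ?memv_line.
exists (k.2 *: (v *m J)); first by rewrite memvZ ?memv_line.
by rewrite /kmx /= mulmxDr mul_mx_scalar -scalemxAr.
Qed.

Lemma kmx_row_inj (v : 'rV[F]_N.+1) k : v *m kmx J k = 0 -> k != 0 -> v = 0.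
Proof.
move=> vk0 /(kmx_inv t_irr JJ)[l /mulmx1C kl].
by rewrite -[v]mulmx1 -kl mulmxA vk0 mul0mx.
Qed.

Lemma dim_kline v : v != 0 -> \dim (kline v) = 2%N.
Proof.
move=> v0; rewrite /kline dimv_disjoint_sum ?dim_vline.
  have -> : v *m J != 0.
    apply: contraNneq v0 => vJ; apply/eqP; apply: (@kmx_row_inj _ (0, 1)).
      by rewrite /kmx /= raddf0 add0r scale1r.
    by apply/eqP => -[/eqP]; rewrite oner_eq0.
  by rewrite v0.
apply/eqP; rewrite -subv0.
apply/subvP => _ /memv_capP[/vlineP[x ->] /vlineP[y e]].
have [[x0 _]|xy] := eqVneq ((x, - y) : F * F) 0; last first.
  have v00 : v = 0.
    apply: (@kmx_row_inj _ (x, - y)) xy.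
    by rewrite /kmx /= mulmxDr mul_mx_scalar -scalemxAr e scaleNr subrr.
  by rewrite v00 eqxx in v0.
by rewrite x0 scale0r mem0v.
Qed.

(** The line of [v] is also the line of [u], where one row of the [2 x 2] matrix
    of values vanishes, so that a dependency between its columns is visible. *)
Lemma kline_meets (a b : 'cV[F]_N.+1) v u :
  u \in kline v -> u != 0 -> u *m a = 0 -> u *m b = 0 -> meets J a b v.
Proof.
move=> /mem_klineP[k ->] u0 ua ub.
have k0 : k != 0.
  by apply: contraNneq u0 => ->; rewrite /kmx /= raddf0 scale0r addr0 mulmx0.
set w := v *m kmx J k in u0 ua ub.
have kw x y : x *: (w *m J *m a) + y *: (w *m J *m b) = 0 ->
    kills J v (x *: a + y *: b).
  move=> e; apply: (kills_row t_irr JJ k0).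
  by rewrite -/w /kills !mulmxDr -!scalemxAr ua ub !scaler0 addr0 e !eqxx.
(* [(x, - y)] solves the one remaining equation, unless it vanishes. *)
pose y := (w *m J *m a) 0 0; pose x := (w *m J *m b) 0 0.
apply/existsP; have [xy0|xy0] := eqVneq ((x, - y) : F * F) 0.
  exists (1, 0); apply/andP; split.
    by apply/eqP => -[/eqP]; rewrite oner_eq0.
  apply: kw => /=; rewrite scale0r addr0 scale1r [LHS]mx11_scalar -/y.
  by case: xy0 => _ /eqP; rewrite oppr_eq0 => /eqP ->; rewrite raddf0.
exists (x, - y); rewrite xy0; apply: kw => /=.
rewrite [w *m J *m a]mx11_scalar [w *m J *m b]mx11_scalar -/x -/y.
by rewrite !scale_scalar_mx mulNr mulrC -raddfD subrr raddf0.
Qed.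

(** Zero vectors among the [v i] give no line; they satisfy [meets] for every
    pair, so dropping them is harmless. *)
Lemma unmet_klines_blocking (m : nat) (v : 'I_m -> 'rV[F]_N.+1) :
  (forall a b, indep a b -> exists i, ~~ meets J a b (v i)) ->
  exists L : {set pg_line F N}, (#|L| <= m)%N /\ higgledy_piggledy L.
Proof.
move=> unmet.
pose K := [set kline (v i) | i : 'I_m].
exists [set l : pg_line F N | val l \in K]; split.
  rewrite -(card_imset _ val_inj) -[X in (_ <= X)%N]card_ord.
  apply: leq_trans (leq_imset_card (fun i => kline (v i)) _).
  by apply: subset_leq_card; apply/subsetP => _ /imsetP[l + ->]; rewrite inE.
move=> H; set S := \bigcup_(l in _) _; set W := pg_span _.
have WH : (W <= val H)%VS.
  by apply/subv_sumP => P; rewrite !inE => /andP[_].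
apply/eqP; rewrite eqEsubv WH /=; apply: contraT => /subvPn[w wH wW].
have dimH : \dim (val H) = N by apply/eqP; exact: (valP H).
have [w0 _ w0H] : exists2 w0, w0 \in fullv & w0 \notin val H.
  apply/subvPn; apply/negP => /dimvS.
  by rewrite dimH dimvf /dim /= mul1n ltnn.
have [a [aH w0a]] := separating_functional w0H.
have [b [bW wb]] := separating_functional wW.
have ab : indep a b.
  apply/indepP => x y e.
  have y0 : y = 0.
    have := congr1 (mulmx w) e.
    rewrite mulmxDr -!scalemxAr aH // scaler0 add0r mulmx0.
    by move=> /eqP; rewrite scaler_eq0 (negPf wb) orbF => /eqP.
  split=> //; have := congr1 (mulmx w0) e.
  rewrite y0 scale0r addr0 mulmx0 -scalemxAr => /eqP.
  by rewrite scaler_eq0 (negPf w0a) orbF => /eqP.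
have [i /negP[]] := unmet a b ab.
have [vi0|vi0] := eqVneq (v i) 0.
  apply/existsP; exists (1, 0); apply/andP; split.
    by apply/eqP => -[/eqP]; rewrite oner_eq0.
  by rewrite vi0 /kills !mul0mx eqxx.
have [u ul u0] : exists2 u, u \in (kline (v i) :&: val H)%VS & u != 0.
  exists (vpick (kline (v i) :&: val H)%VS); first exact: memv_pick.
  rewrite vpick0 -dimv_eq0 -lt0n -(ltn_add2l (\dim (kline (v i) + val H)%VS)).
  rewrite dimv_sum_cap dim_kline // dimH addn0.
  apply: (@leq_ltn_trans N.+1) => //.
  by apply: leq_trans (dimvS (subvf _)) _; rewrite dimvf /dim /= mul1n.
move: ul => /memv_capP[ul uH].
have uW : u \in W.
  have P1 : \dim <[u]>%VS == 1%N by rewrite dim_vline u0.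
  pose P : pg_point F N := exist _ <[u]>%VS P1.
  have l2 : \dim (kline (v i)) == 2%N by rewrite dim_kline.
  pose l : pg_line F N := exist _ (kline (v i)) l2.
  apply: (subvP (sumv_sup P _ (subvv _))); last exact: memv_line.
  rewrite !inE /= -memvE uH andbT; apply/bigcupP; exists l.
    by rewrite inE /=; apply: imset_f.
  by rewrite inE /= -memvE.
exact: kline_meets ul u0 (aH _ uH) (bW _ uW).
Qed.

End SpreadLines.

(** * Numerical estimates *)

Lemma ln2_le1 (R : realType) : ln 2 <= 1 :> R.
Proof. by have := @le_ln1Dx R 1; apply; rewrite (lt_trans (ltrN10 R)). Qed.

(** [(1 + 1 / q) ^ m <= exp (m / q) < exp (ln 2)]. *)
Lemma pow_succ_lt_double (R : realType) (m n q : nat) : (m <= n)%N ->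
  n%:R / ln 2 < q%:R :> R -> (q.+1 ^ m < 2 * q ^ m)%N.
Proof.
move=> mn nq.
have ln2 : 0 < ln 2 :> R by rewrite ln_gt0 // ltr1n.
have q0 : 0 < q%:R :> R by apply: le_lt_trans nq; rewrite divr_ge0 // ltW.
have q1 : (0 : R) < 1 + q%:R^-1 by rewrite ltr_pwDl // invr_ge0 ltW.
rewrite -(ltr_nat R) natrM !natrX -natr1.
have -> : q%:R + 1 = q%:R * (1 + q%:R^-1) :> R.
  by rewrite mulrDr mulr1 mulfV ?gt_eqF.
rewrite exprMn mulrC ltr_pM2r ?exprn_gt0 //.
apply: le_lt_trans (_ : expR (m%:R / q%:R) < 2).
  rewrite mulrC expRM_natr.
  apply: lerXn2r; rewrite ?nnegrE ?expR_ge0 ?(ltW q1) //.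
  exact: expR_ge1Dx.
rewrite -[X in _ < X](@lnK R) ?posrE // ltr_expR ltr_pdivrMr //.
rewrite mulrC -ltr_pdivrMr //; apply: le_lt_trans nq.
by rewrite ler_pM2r ?invr_gt0 // ler_nat.
Qed.

Lemma orbit_size_ge (q : nat) : (8 < q)%N ->
  (2 * q ^ 5 <= (q ^ 2).-1 * q * (q * q.-1) * q.-1)%N.
Proof.
case: q => // p p8; rewrite -[p.+1.-1]/p.
have -> : (p.+1 ^ 2).-1 = (p * (p + 2))%N by rewrite expnS expn1; lia.
rewrite !(expnS p.+1) expn0.
have [r ->] : exists r, p = (8 + r)%N by exists (p - 8)%N; lia.
nia.
Qed.

(** After multiplication by [q], the term for functionals that kill every vector
    is at most [M q ^ (2m)] with [m = 4n - 4], because [2n + 1 <= 2m].  This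
    leaves [(q - 1) M q ^ (2m)] for the pairs, hence the factor [q - 1] in the
    bound on [M]. *)
Lemma orbit_beats_union (n q M : nat) : (2 <= n)%N -> (0 < q)%N ->
  (2 * q ^ 5 <= M * q.-1)%N ->
  (q.+1 ^ (4 * n - 4) < 2 * q ^ (4 * n - 4))%N ->
  (q ^ (2 * (2 * n)) * q.+1 ^ (4 * n - 4) + M * q ^ (2 * n) <
   M * q ^ (2 * (4 * n - 4)))%N.
Proof.
move=> n2 q0 Mq lt2.
have -> : (2 * (2 * n) = 4 + (4 * n - 4))%N by lia.
have le_n : (q ^ (2 * n) * q <= q ^ (2 * (4 * n - 4)))%N.
  by rewrite -expnSr leq_pexp2l; lia.
rewrite (_ : (q ^ (2 * (4 * n - 4)))%N =
             (q ^ (4 * n - 4) * q ^ (4 * n - 4))%N) in le_n *; last first.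
  by rewrite -expnD; congr (_ ^ _)%N; lia.
rewrite expnD; have X0 : (0 < q ^ (4 * n - 4))%N by rewrite expn_gt0; lia.
move: lt2 X0 Mq le_n; rewrite [(q ^ 5)%N]expnS.
have Q4 : (0 < q ^ 4)%N by rewrite expn_gt0; lia.
move: (q ^ (4 * n - 4))%N (q ^ 4)%N (q.+1 ^ (4 * n - 4))%N (q ^ (2 * n))%N M Q4.
case: q q0 => // p _ X Q Y Z M Q0 /= lt2 X0 Mq leZ.
have h1 : (Q * X * Y < Q * X * (2 * X))%N by rewrite ltn_pmul2l // muln_gt0 Q0.
have h2 := leq_mul leZ (leqnn M).
have h3 := leq_mul Mq (leqnn (X * X)).
rewrite -(ltn_pmul2l (ltn0Sn p)).
nia.
Qed.

Theorem theorem3p2 (R : realType) (n : nat) (F : finFieldType)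
    (hn : (2 <= n)%N)
    (hq : 4 * n%:R / ln 2 < #|F|%:R :> R) :
  exists L : {set pg_line F (2 * n - 1)},
    (#|L| <= 4 * n - 4)%N /\ higgledy_piggledy L.
Proof.
have hq' : (4 * n)%:R / ln 2 < #|F|%:R :> R by rewrite natrM.
have q8 : (8 < #|F|)%N.
  rewrite -(ltr_nat R); apply: le_lt_trans hq'.
  rewrite ler_pdivlMr ?ln_gt0 ?ltr1n //.
  apply: le_trans (_ : 8 * 1 <= _); first by rewrite ler_pM2l // ln2_le1.
  by rewrite mulr1 ler_nat; lia.
have [t t_irr] := exists_non_artin_schreier F.
have [J JJ] : exists J : 'M[F]_((2 * n - 1).+1), J *m J = J + t%:M.
  by apply: (@exists_quadratic_matrix _ n); lia.
have := @exists_unmet_family F t (2 * n - 1).+1 J t_irr JJ (4 * n - 4).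
case.
  rewrite card_orbit_index (_ : (2 * n - 1).+1 = 2 * n)%N; last by lia.
  apply: orbit_beats_union hn (ltnW (leq_ltn_trans _ q8)) (orbit_size_ge q8) _.
    by [].
  by apply: (pow_succ_lt_double _ hq'); lia.
by move=> v /(unmet_klines_blocking t_irr JJ).
Qed.
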